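(* Let $m \geq 1$ be an integer. The pair of sequences $(\mathsf{G}, \mathsf{g}) = \big((\mathsf{G}_i)_{i \in \mathbb{N}}, (\mathsf{g}_i)_{i \in \mathbb{N}}\big)$ defined by $$\mathsf{G}_i = m^i\, i! \quad \text{and} \quad \mathsf{g}_i = m(i+1)-1$$ is a number system.
   Context: $\mathbb{N}=\{0,1,2,\dots\}$. Let $\mathsf{A} = (\mathsf{A}_i)_{i \in \mathbb{N}}$ be a sequence of positive integers and $\mathsf{a} = (\mathsf{a}_i)_{i \in \mathbb{N}}$ a sequence of nonnegative integers. The pair $(\mathsf{A}, \mathsf{a})$ is called a number system if, for every $n \in \mathbb{N}$, there exists $k \in \mathbb{N}$ such that $n = \sum_{i=0}^{k} \alpha_i \mathsf{A}_i$ with integers $\alpha_i \in \{0,1,\dots,\mathsf{a}_i\}$, and this representation in terms of the $\mathsf{A}_i$'s and $\alpha_i$'s is unique (two representations being identified if they differ only by leading terms with $\alpha_i = 0$). *)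

(* Defs.v *)
From mathcomp Require Import all_boot.

Set Implicit Arguments.
Unset Strict Implicit.
Unset Printing Implicit Defensive.

Definition represents (A a : nat -> nat) (n k : nat) (s : k.+1.-tuple nat) :
    Prop :=
  (forall i : 'I_k.+1, tnth s i <= a i) /\
  n = \sum_(i < k.+1) tnth s i * A i.

(* The digit sequences s and t may have different lengths.  [nth 0] pads them
   with zeros, so the equation below says that s and t differ at most by
   leading zero digits. *)
Definition same_digits (k l : nat) (s : k.+1.-tuple nat) (t : l.+1.-tuple nat) :
    Prop :=
  forall i : nat, nth 0 s i = nth 0 t i.

Definition number_system (A a : nat -> nat) : Prop :=
  [/\ forall i : nat, 0 < A i,
      forall n : nat,
        exists (k : nat) (s : k.+1.-tuple nat), represents A a n s
    & forall (n k l : nat) (s : k.+1.-tuple nat) (t : l.+1.-tuple nat),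
        represents A a n s -> represents A a n t -> same_digits s t].

(* Main.v *)
Require Import Defs.
From mathcomp Require Import all_boot.

(** In a mixed-radix system, i.e. when [A 0 = 1] and [A i.+1 = (a i).+1 * A i],
    the number formed by the first [k] digits is less than [A k].  Euclidean
    division by [A k] therefore recovers the digit of index [k] from the first
    [k.+1] ones, which gives existence and uniqueness by induction on [k]. *)

Section MixedRadix.

Variables A a : nat -> nat.
Hypothesis A0 : A 0 = 1.
Hypothesis AS : forall i, A i.+1 = (a i).+1 * A i.

Lemma radix_gt0 i : 0 < A i.
Proof. by elim: i => [|i IHi]; rewrite ?A0 // AS muln_gt0. Qed.

Lemma digit_sum_lt (d : nat -> nat) k :
  (forall i, d i <= a i) -> \sum_(i < k) d i * A i < A k.
Proof.
move=> le_da; elim: k => [|k IHk]; first by rewrite big_ord0 A0.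
(* Here [A k.+1] splits as [A k + a k * A k]: the first summand strictly bounds the lower digits,
   the second bounds the top term. *)
rewrite big_ord_recr AS mulSn /= -addSn leq_add //.
by rewrite leq_mul2r le_da orbT.
Qed.

Lemma digit_sum_inj (d e : nat -> nat) k :
    (forall i, d i <= a i) -> (forall i, e i <= a i) ->
    \sum_(i < k) d i * A i = \sum_(i < k) e i * A i ->
  forall i, i < k -> d i = e i.
Proof.
move=> le_da le_ea; elim: k => [//|k IHk].
rewrite !big_ord_recr /= => eq_de.
have quotE (f : nat -> nat) : (forall i, f i <= a i) ->
    (\sum_(i < k) f i * A i + f k * A k) %/ A k = f k.
  move=> le_fa.
  by rewrite addnC divnMDl ?radix_gt0 // divn_small ?addn0 // digit_sum_lt.
have eq_k : d k = e k by rewrite -(quotE d) // eq_de quotE.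
move: eq_de; rewrite eq_k => /addIn /IHk eq_lt i.
by rewrite ltnS leq_eqVlt => /predU1P [-> //|]; apply: eq_lt.
Qed.

Lemma digit_sum_exists k n :
  n < A k ->
  exists2 d : nat -> nat, forall i, d i <= a i & n = \sum_(i < k) d i * A i.
Proof.
elim: k n => [|k IHk] n.
  by rewrite A0 ltnS leqn0 => /eqP ->; exists (fun=> 0); rewrite ?big_ord0.
rewrite AS => lt_n.
have [d le_da mod_n] := IHk (n %% A k) (ltn_pmod n (radix_gt0 k)).
(* The remainder mod [A k] supplies the lower digits and the quotient is the top one; it is at most
   [a k] because [n < (a k).+1 * A k]. *)
exists (fun i => if i == k then n %/ A k else d i) => [i|].
  by case: eqP => [-> | //]; rewrite -ltnS ltn_divLR ?radix_gt0.
rewrite big_ord_recr /= eqxx [LHS](divn_eq n (A k)) addnC mod_n.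
by congr (_ + _); apply: eq_bigr => i _; rewrite ltn_eqF.
Qed.

(** Padding with the default digit 0 brings representations of different lengths to a common length
    [l], where [digit_sum_inj] can compare them. *)
Lemma represents_nth n k (s : k.+1.-tuple nat) l :
    represents A a n s -> k < l ->
  (forall i, nth 0 s i <= a i) /\ n = \sum_(i < l) nth 0 s i * A i.
Proof.
move=> [le_sa ->] lt_kl; split=> [i|].
  have [lt_ik|le_ki] := ltnP i k.+1; last by rewrite nth_default ?size_tuple.
  by rewrite -(tnth_nth 0 s (Ordinal lt_ik)) le_sa.
rewrite (eq_bigr (fun i : 'I_k.+1 => nth 0 s i * A i)); last first.
  by move=> i _; rewrite (tnth_nth 0).
rewrite (@big_ord_widen _ _ _ k.+1 l (fun i => nth 0 s i * A i)) //.
rewrite [LHS]big_mkcond.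
apply: eq_bigr => i _; case: ltnP => // le_ki.
by rewrite nth_default ?size_tuple.
Qed.

(** The unboundedness hypothesis excludes the case where [a] is eventually zero: [A] is then
    eventually constant and large numbers have no representation. *)
Lemma mixed_radix_number_system :
  (forall n, exists k, n < A k.+1) -> number_system A a.
Proof.
move=> A_unbounded; split=> [|n|n k l s t rep_s rep_t i]; first exact: radix_gt0.
  have [k /digit_sum_exists [d le_da ->]] := A_unbounded n.
  exists k, [tuple d i | i < k.+1]; split=> [i|]; first by rewrite tnth_mktuple.
  by apply: eq_bigr => i _; rewrite tnth_mktuple.
(* Length [j.+1] covers both tuples and also the index [i], which may lie beyond either of them. *)
pose j := maxn i (maxn k l).
have [|le_sa eq_s] := represents_nth _ _ _ j.+1 rep_s.
  by rewrite ltnS !leq_max leqnn orbT.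
have [|le_ta eq_t] := represents_nth _ _ _ j.+1 rep_t.
  by rewrite ltnS !leq_max leqnn !orbT.
by apply: (digit_sum_inj _ _ j.+1); rewrite -?eq_s // ltnS leq_maxl.
Qed.

End MixedRadix.

Theorem corollary1p4 (m : nat) (hm : 1 <= m) :
  number_system (fun i : nat => m ^ i * i`!) (fun i : nat => m * (i + 1) - 1).
Proof.
apply: mixed_radix_number_system => [//|i|n].
  by rewrite subn1 addn1 prednK ?muln_gt0 ?hm // expnS factS mulnACA.
exists n; rewrite factS mulnCA -[X in X <= _]muln1 leq_mul //.
by rewrite muln_gt0 expn_gt0 hm fact_gt0.
Qed.
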